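(* Let $\nu>0$ and consider on the real line $x\in\mathbb{R}$ the equation $\omega_t=\omega\,\mathcal{H}(\omega)-\nu\,\omega$. Let $\omega_{-1}(0),v_c(0)\in\mathbb{C}$ with $\mathrm{Re}[v_c(0)]>0$, and set $$\omega_{-1}(t)=\omega_{-1}(0)e^{-\nu t},\qquad v_c(t)=\frac{\omega_{-1}(0)}{\nu}(1-e^{-\nu t})+v_c(0),\qquad \omega(x,t)=\frac{\omega_{-1}(t)}{x-iv_c(t)}+\frac{\overline{\omega_{-1}(t)}}{x+i\,\overline{v_c(t)}} .$$ Then $\omega$ is an exact real-valued solution as long as $\mathrm{Re}[v_c(t)]>0$, with $$\|\omega(\cdot,t)\|_{L^\infty}=\frac{|\omega_{-1}(t)|+|\mathrm{Im}[\omega_{-1}(t)]|}{\mathrm{Re}[v_c(t)]},\qquad \|\omega(\cdot,t)\|_{L^2}=\sqrt{2\pi}\,\frac{|\omega_{-1}(t)|}{\sqrt{\mathrm{Re}[v_c(t)]}},$$ and: (a) if $\mathrm{Re}[\omega_{-1}(0)]>-\nu\,\mathrm{Re}[v_c(0)]$, then $\mathrm{Re}[v_c(t)]>0$ for all $t>0$ and the solution exists for all $t>0$; (b) if $\mathrm{Re}[\omega_{-1}(0)]=-\nu\,\mathrm{Re}[v_c(0)]$, then $\mathrm{Re}[v_c(t)]=\mathrm{Re}[v_c(0)]e^{-\nu t}$, the solution exists for all $t>0$, $\|\omega(\cdot,t)\|_{L^\infty}=\|\omega(\cdot,0)\|_{L^\infty}>0$ for all $t$, and $\|\omega(\cdot,t)\|_{L^2}$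 decays to $0$ like $e^{-\nu t/2}$ as $t\to\infty$; (c) if $\mathrm{Re}[\omega_{-1}(0)]<-\nu\,\mathrm{Re}[v_c(0)]$, the solution exists until $$t_c=-\frac1\nu\ln\left(1+\frac{\nu\,\mathrm{Re}[v_c(0)]}{\mathrm{Re}[\omega_{-1}(0)]}\right),$$ when the poles reach the real axis at $$x_c=\frac{\mathrm{Im}[\omega_{-1}(0)]}{\mathrm{Re}[\omega_{-1}(0)]}\mathrm{Re}[v_c(0)]-\mathrm{Im}[v_c(0)];$$ both $\|\omega(\cdot,t)\|_{L^\infty}$ and $\|\omega(\cdot,t)\|_{L^2}$ tend to $\infty$ as $t\to t_c^-$, and as $x\to x_c$, $t\to t_c^-$, $$\omega(x,t)=\frac{i}{t_c-t}\left(\frac{\xi_+}{\xi-\xi_+}-\frac{\xi_-}{\xi-\xi_-}\right)+O(1),\qquad \xi=\frac{x-x_c}{t_c-t},\quad \xi_+=-i\,\omega_{-1}(t_c),\quad \xi_-=i\,\overline{\omega_{-1}(t_c)} .$$ In case (c), $\|\omega(\cdot,0)\|_{L^\infty}>\nu$, while $\|\omega(\cdot,0)\|_{L^2}$ can be made arbitrarily small by a suitable choice of data with small $v_c(0)$.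
   Context: On the real line $\mathcal{H}f(x)=\frac1\pi\,\mathrm{PV}\int_{-\infty}^\infty\frac{f(x')}{x-x'}\,dx'$ (Fourier symbol $-i\,\mathrm{sgn}(k)$). This is the generalized Constantin–Lax–Majda equation $\omega_t=-au\omega_x+\omega\mathcal{H}(\omega)-\nu\Lambda^\sigma\omega$ with $a=0$, $\sigma=0$, where $\Lambda^0\omega=\omega$. *)

(* Defs.v *)
From HB Require Import structures.
From mathcomp Require Import all_boot all_order all_algebra.
From mathcomp Require Import all_classical all_reals all_analysis.
From mathcomp Require Import complex.
Set Implicit Arguments.
Unset Strict Implicit.
Unset Printing Implicit Defensive.
Import Order.TTheory GRing.Theory Num.Theory.
Import numFieldNormedType.Exports.
Local Open Scope classical_set_scope.
Local Open Scope ring_scope.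
Local Open Scope complex_scope.

(* The modulus of a complex number as a real number (the norm `|z| of R[i]
   takes its values in R[i]). *)
Definition cmod (R : realType) (z : R[i]) : R := ComplexField.Normc.normc z.

Definition pv_trunc (R : realType) (f : R -> R) (x eps : R) : R :=
  \int[lebesgue_measure]_(y in [set y : R | eps < `|x - y|]) (f y / (x - y)).

(* The truncated integrals are Lebesgue integrals: this covers every f in L^p
   with 1 <= p < +oo, so no symmetric truncation at infinity is used. *)
Definition hilbert_exists (R : realType) (f : R -> R) (x : R) : Prop :=
  (forall eps : R, 0 < eps ->
     lebesgue_measure.-integrable [set y : R | eps < `|x - y|]
       (EFin \o (fun y : R => f y / (x - y))))
  /\ cvg (pv_trunc f x eps @[eps --> 0^'+]).

(* Junk unless hilbert_exists f x holds. *)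
Definition hilbert (R : realType) (f : R -> R) (x : R) : R :=
  pi^-1 * lim (pv_trunc f x eps @[eps --> 0^'+]).

(* [u x t] is a classical solution of u_t = u H(u) - nu u at all times of [I].
   The time derivative is two-sided even at an end point of [I], so [u] must
   be defined around each time of [I]. *)
Definition is_solution (R : realType) (nu : R) (I : set R) (u : R -> R -> R)
    : Prop :=
  forall t, I t -> forall x : R,
    hilbert_exists (u ^~ t) x /\
    is_derive t (1 : R) (u x) (u x t * hilbert (u ^~ t) x - nu * u x t).

(* Norms in the space variable, with values in the extended reals. *)
Definition norm_Linfty (R : realType) (u : R -> R -> R) (t : R) : \bar R :=
  Lnorm (@lebesgue_measure R) +oo%E (EFin \o (u ^~ t)).

Definition norm_L2 (R : realType) (u : R -> R -> R) (t : R) : \bar R :=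
  Lnorm (@lebesgue_measure R) 2%:E (EFin \o (u ^~ t)).

(* [w0] and [v0] are the data omega_{-1}(0) and v_c(0). *)
Definition omega_m1 (R : realType) (nu : R) (w0 : R[i]) (t : R) : R[i] :=
  w0 * (expR (- (nu * t)))%:C.

Definition v_c (R : realType) (nu : R) (w0 v0 : R[i]) (t : R) : R[i] :=
  w0 / nu%:C * (1 - expR (- (nu * t)))%:C + v0.

(* 'i%C and ^*%C are the concrete ones of R[i]; without the delimiter they parse
   as the generic operations of numClosedFieldType. *)
Definition omega (R : realType) (nu : R) (w0 v0 : R[i]) (x t : R) : R[i] :=
  omega_m1 nu w0 t / (x%:C - 'i%C * v_c nu w0 v0 t)
  + (omega_m1 nu w0 t)^*%C / (x%:C + 'i%C * (v_c nu w0 v0 t)^*%C).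

Definition omegaR (R : realType) (nu : R) (w0 v0 : R[i]) (x t : R) : R :=
  complex.Re (omega nu w0 v0 x t).

Definition pole_up (R : realType) (nu : R) (w0 v0 : R[i]) (t : R) : R[i] :=
  'i%C * v_c nu w0 v0 t.

Definition pole_down (R : realType) (nu : R) (w0 v0 : R[i]) (t : R) : R[i] :=
  - ('i%C * (v_c nu w0 v0 t)^*%C).

Definition t_c (R : realType) (nu : R) (w0 v0 : R[i]) : R :=
  - (nu^-1 * ln (1 + nu * complex.Re v0 / complex.Re w0)).

Definition x_c (R : realType) (w0 v0 : R[i]) : R :=
  complex.Im w0 / complex.Re w0 * complex.Re v0 - complex.Im v0.

Definition xi_plus (R : realType) (nu : R) (w0 v0 : R[i]) : R[i] :=
  - ('i%C * omega_m1 nu w0 (t_c nu w0 v0)).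

Definition xi_minus (R : realType) (nu : R) (w0 v0 : R[i]) : R[i] :=
  'i%C * (omega_m1 nu w0 (t_c nu w0 v0))^*%C.

Definition self_similar_profile (R : realType) (nu : R) (w0 v0 : R[i])
    (x t : R) : R[i] :=
  let tau := t_c nu w0 v0 - t in
  let xi := ((x - x_c w0 v0) / tau)%:C in
  let xp := xi_plus nu w0 v0 in
  let xm := xi_minus nu w0 v0 in
  'i%C / tau%:C * (xp / (xi - xp) - xm / (xi - xm)).

(* Main.v *)
Require Import Defs.
From HB Require Import structures.
From mathcomp Require Import all_boot all_order all_algebra.
From mathcomp Require Import all_classical all_reals all_analysis.
From mathcomp Require Import complex.
From mathcomp Require Import measurable_realfun ftc ess_sup_inf ring lra.
Set Implicit Arguments.
Unset Strict Implicit.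
Unset Printing Implicit Defensive.
Import Order.TTheory GRing.Theory Num.Theory.
Import numFieldNormedType.Exports.
Local Open Scope classical_set_scope.
Local Open Scope ring_scope.
Local Open Scope complex_scope.

(** At a fixed time, the solution is a real function with two conjugate simple
    poles,
      u(y) = 2 Re ((a + i b) / (y + m - i r)),
    where a + i b is the residue, r > 0 and m are the real and imaginary parts
    of v_c; such a function is called [dipole a b m r] below, and [omegaRE]
    identifies the solution with it.  Everything reduces to four facts about
    dipoles.

    - Hilbert transform ([hilbert_dipole]).  The term (a + i b) / (y + m - i r)
      is holomorphic in the lower half plane and decays, so H multiplies it by
      i: H sends [dipole a b m r] to [dipole (- b) a m r].  The proof is real:
      by partial fractions, u(y) / (x - y) has an explicit primitive made of
      logarithms and an arctangent, and the integrals over the two half lines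
      at distance e from x are read off from it.
    - Evolution ([is_derive_dipole_param]).  For A = w / (x - i v), the equation
      A_t = i A^2 - nu A holds as soon as w' = - nu w and v' = w.  Adding the
      conjugate gives u_t = u H(u) - nu u, because
      i A^2 - i conj(A)^2 = (A + conj A) (i A - i conj A).
    - Supremum norm ([Linfty_dipole]).  With M = |a + i b|, the inequality
      |u| <= (M + |b|) / r amounts to the nonnegativity of the perfect square
      ((M + |b|) s - |a| r)^2, s = |y + m|, and the square vanishes somewhere.
    - Square norm ([Lnorm2_dipole]).  An explicit primitive of u^2 is available.

    Since Re v_c = (Re w0 / nu) (1 - E) + Re v0 with E = expR (- (nu t)), the
    trichotomy is elementary; in the last case
    Re v_c = - (Re w0 / nu) (E - E_c), which vanishes exactly at [t_c].  The
    distance of the pole to x differs from its linearization at [t_c] by a term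
    of second order in t_c - t, while both are bounded below by a multiple of
    t_c - t; this bounds the error of the self-similar profile uniformly in x
    and in t < t_c ([pole_term_error], [self_similar_error]). *)

(** * Fundamental theorem of calculus on half lines *)

Lemma ge0_integral_itvoy_FTC (R : realType) (f F : R -> R) (a l : R) :
  (forall y, a <= y -> 0 <= f y) ->
  (forall y, a <= y -> {for y, continuous f}) ->
  (forall y, a <= y -> is_derive y (1 : R) F (f y)) ->
  F y @[y --> +oo] --> l ->
  (\int[lebesgue_measure]_(y in `]a, +oo[) (f y)%:E = (l - F a)%:E)%E.
Proof.
move=> f0 cf dF Fl.
have mf : measurable_fun `]a, +oo[ f.
  apply: open_continuous_measurable_fun => // y; rewrite inE/= in_itv/= andbT.
  by move=> /ltW; exact: cf.
rewrite integral_itv_obnd_cbnd; last exact/measurable_EFinP.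
rewrite (@ge0_continuous_FTC2y _ f F a l)//.
- apply/continuous_within_itvcyP; split.
    by move=> y; rewrite in_itv/= andbT => /ltW; exact: cf.
  by apply: cvg_at_right_filter; exact: cf.
- by move=> y /ltW ay; have [] := dF y ay.
- apply: cvg_at_right_filter; apply: differentiable_continuous.
  by apply/derivable1_diffP; have [] := dF a (lexx a).
- move=> y; rewrite in_itv/= andbT => /ltW ay.
  by rewrite derive1E; have [] := dF y ay.
Qed.

Lemma ge0_integral_itvNyo_FTC (R : realType) (f F : R -> R) (a l : R) :
  (forall y, y <= a -> 0 <= f y) ->
  (forall y, y <= a -> {for y, continuous f}) ->
  (forall y, y <= a -> is_derive y (1 : R) F (f y)) ->
  F y @[y --> -oo] --> l ->
  (\int[lebesgue_measure]_(y in `]-oo, a[) (f y)%:E = (F a - l)%:E)%E.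
Proof.
move=> f0 cf dF Fl.
(* Reflecting y into - y reduces to the half line on the right. *)
have le_oppr y : - a <= y -> - y <= a by rewrite lerNl.
have cfN y : - a <= y -> {for y, continuous (f \o -%R)}.
  by move=> ay; apply: continuous_comp; [exact: opp_continuous|exact/cf/le_oppr].
have mf : measurable_fun `]-oo, a[ f.
  apply: open_continuous_measurable_fun => // y; rewrite inE/= in_itv/=.
  by move=> /ltW; exact: cf.
rewrite integral_itv_bndo_bndc; last exact/measurable_EFinP.
rewrite -[in LHS](opprK a) ge0_integration_by_substitutionNy; last 2 first.
- rewrite opprK; apply/continuous_within_itvNycP; split.
    by move=> y; rewrite in_itv/= => /ltW; exact: cf.
  by apply: cvg_at_left_filter; exact: cf.
- by rewrite opprK => y; rewrite in_itv/= => /ltW; exact: f0.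
rewrite -integral_itv_obnd_cbnd; last first.
  apply/measurable_EFinP.
  apply: open_continuous_measurable_fun => // y; rewrite inE/= in_itv/= andbT.
  by move=> /ltW; exact: cfN.
have -> : F a - l = - l - (fun y => - F (- y)) (- a) by rewrite /= !opprK addrC.
apply: (@ge0_integral_itvoy_FTC _ _ (fun y => - F (- y))) => //.
- by move=> y ay; exact/f0/le_oppr.
- move=> y ay; have dFy := dF _ (le_oppr _ ay).
  have -> : (f \o -%R) y = - (f (- y) * - 1) by rewrite /= mulrN1 opprK.
  exact: is_deriveN.
- by apply: cvgN; apply/cvgNy_compNP.
Qed.

(** Splitting f as (f + g) - g: both functions are nonnegative, so that their
    integrals are available without knowing integrability in advance. *)
Lemma integrable_dominated (R : realType) (D : set R) (f g : R -> R)
    (If Ig : R) :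
  measurable D -> measurable_fun D f -> measurable_fun D g ->
  (forall y, D y -> `|f y| <= g y) ->
  (\int[lebesgue_measure]_(y in D) (g y)%:E = Ig%:E)%E ->
  (\int[lebesgue_measure]_(y in D) (f y + g y)%:E = (If + Ig)%:E)%E ->
  lebesgue_measure.-integrable D (EFin \o f) /\
  \int[lebesgue_measure]_(y in D) f y = If.
Proof.
move=> mD mf mg fg eg efg.
have ig : lebesgue_measure.-integrable D (EFin \o g).
  apply/integrableP; split; first exact/measurable_EFinP.
  rewrite (_ : integral _ _ _ = Ig%:E) ?ltry// -eg.
  apply: eq_integral => y; rewrite inE => Dy /=.
  by rewrite ger0_norm// (le_trans _ (fg _ Dy)).
have jf : lebesgue_measure.-integrable D (EFin \o f).
  apply: le_integrable ig => //; first exact/measurable_EFinP.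
  move=> y Dy /=; rewrite lee_fin (ger0_norm (le_trans _ (fg _ Dy)))//.
  exact: fg.
split => //; apply: (addIr Ig).
have Rg : \int[lebesgue_measure]_(y in D) g y = Ig by rewrite /Rintegral eg.
rewrite -{1}Rg -RintegralD//.
by rewrite /Rintegral efg.
Qed.

(** Fundamental theorem of calculus on a half line for an integrand without a
    constant sign; integrability comes from a majorant whose primitive also has
    a limit. *)
Lemma integrable_itvoy_FTC (R : realType) (f F g G : R -> R) (a l k : R) :
  (forall y, a <= y -> `|f y| <= g y) ->
  (forall y, a <= y -> {for y, continuous f}) ->
  (forall y, a <= y -> {for y, continuous g}) ->
  (forall y, a <= y -> is_derive y (1 : R) F (f y)) ->
  (forall y, a <= y -> is_derive y (1 : R) G (g y)) ->
  F y @[y --> +oo] --> l -> G y @[y --> +oo] --> k ->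
  lebesgue_measure.-integrable `]a, +oo[ (EFin \o f) /\
  \int[lebesgue_measure]_(y in `]a, +oo[) f y = l - F a.
Proof.
move=> fg cf cg dF dG Fl Gk.
have mc (h : R -> R) : (forall y, a <= y -> {for y, continuous h}) ->
    measurable_fun `]a, +oo[ h.
  move=> ch; apply: open_continuous_measurable_fun => // y.
  by rewrite inE/= in_itv/= andbT => /ltW; exact: ch.
apply: (@integrable_dominated _ _ f g _ (k - G a)) => //;
  [exact: mc|exact: mc| | |].
- by move=> y /=; rewrite in_itv/= andbT => /ltW; exact: fg.
- apply: ge0_integral_itvoy_FTC => // y ay.
  by rewrite (le_trans _ (fg y ay)).
- have -> : l - F a + (k - G a) = l + k - (F a + G a).
    by ring.
  apply: (@ge0_integral_itvoy_FTC _ _ (F + G)).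
  + move=> y ay; have := fg y ay; rewrite ler_norml => /andP[+ _].
    by rewrite -subr_ge0 opprK.
  + by move=> y ay; apply: continuousD; [exact: cf|exact: cg].
  + by move=> y ay; apply: is_deriveD; [exact: dF|exact: dG].
  + exact: cvgD.
Qed.

Lemma integrable_itvNyo_FTC (R : realType) (f F g G : R -> R) (a l k : R) :
  (forall y, y <= a -> `|f y| <= g y) ->
  (forall y, y <= a -> {for y, continuous f}) ->
  (forall y, y <= a -> {for y, continuous g}) ->
  (forall y, y <= a -> is_derive y (1 : R) F (f y)) ->
  (forall y, y <= a -> is_derive y (1 : R) G (g y)) ->
  F y @[y --> -oo] --> l -> G y @[y --> -oo] --> k ->
  lebesgue_measure.-integrable `]-oo, a[ (EFin \o f) /\
  \int[lebesgue_measure]_(y in `]-oo, a[) f y = F a - l.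
Proof.
move=> fg cf cg dF dG Fl Gk.
have mc (h : R -> R) : (forall y, y <= a -> {for y, continuous h}) ->
    measurable_fun `]-oo, a[ h.
  move=> ch; apply: open_continuous_measurable_fun => // y.
  by rewrite inE/= in_itv/= => /ltW; exact: ch.
apply: (@integrable_dominated _ _ f g _ (G a - k)) => //;
  [exact: mc|exact: mc| | |].
- by move=> y /=; rewrite in_itv/= => /ltW; exact: fg.
- apply: ge0_integral_itvNyo_FTC => // y ay.
  by rewrite (le_trans _ (fg y ay)).
- have -> : F a - l + (G a - k) = (F a + G a) - (l + k).
    by ring.
  apply: (@ge0_integral_itvNyo_FTC _ _ (F + G)).
  + move=> y ay; have := fg y ay; rewrite ler_norml => /andP[+ _].
    by rewrite -subr_ge0 opprK.
  + by move=> y ay; apply: continuousD; [exact: cf|exact: cg].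
  + by move=> y ay; apply: is_deriveD; [exact: dF|exact: dG].
  + exact: cvgD.
Qed.

(** * Dipoles and the primitives they require *)

(** Twice the real part of (a + i b) / (y + m - i r): for r > 0, a real function
    with simple poles at - m + i r and - m - i r. *)
Definition dipole (R : realType) (a b m r y : R) : R :=
  2 * (a * (y + m) - b * r) / ((y + m) ^+ 2 + r ^+ 2).

Lemma sqr_addr_sqr_gt0 (R : realType) (s r : R) : 0 < r -> 0 < s ^+ 2 + r ^+ 2.
Proof. by move=> r0; rewrite ltr_wpDl ?sqr_ge0 ?exprn_gt0. Qed.

Lemma is_derive_sqr_addr (R : realType) (m r y : R) :
  is_derive y (1 : R) (fun y => (y + m) ^+ 2 + r ^+ 2) (2 * (y + m)).
Proof. by apply: is_derive_eq; rewrite addr0 /GRing.scale/=; ring. Qed.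

Lemma is_derive_atan_div (R : realType) (m r y : R) : 0 < r ->
  is_derive y (1 : R) (fun y => r^-1 * atan ((y + m) / r))
    ((y + m) ^+ 2 + r ^+ 2)^-1.
Proof.
move=> r0; have N0 := sqr_addr_sqr_gt0 (y + m) r0.
apply: is_derive_eq; rewrite scaler0 add0r addr0 /GRing.scale/=.
by field; rewrite !gt_eqF//= addrC.
Qed.

Lemma is_derive_ln_sqr (R : realType) (m r y : R) : 0 < (y + m) ^+ 2 + r ^+ 2 ->
  is_derive y (1 : R) (fun y => ln ((y + m) ^+ 2 + r ^+ 2))
    (2 * (y + m) / ((y + m) ^+ 2 + r ^+ 2)).
Proof.
move=> /is_derive1_ln dln; have dN := is_derive_sqr_addr m r y.
by rewrite mulrC; exact: (@is_derive1_comp R (@ln R) _ y _ _ dln dN).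
Qed.

Lemma is_derive_continuous (R : realType) (f : R -> R) (y d : R) :
  is_derive y (1 : R) f d -> {for y, continuous f}.
Proof.
by case=> df _; apply: differentiable_continuous; exact/derivable1_diffP.
Qed.

Lemma near_neq (R : realType) (F : set_system R) (FF : Filter F) (c : R) :
  `|y| @[y --> F] --> +oo -> \forall y \near F, y != c.
Proof.
move=> Foo; near=> y; apply/eqP => yc.
suff : `|c| < `|y| by rewrite yc ltxx.
by near: y; move/cvgryPgt : Foo; apply.
Unshelve. all: by end_near. Qed.

Lemma cvgr_inv_subr (R : realType) (F : set_system R) (FF : Filter F) (c : R) :
  `|y| @[y --> F] --> +oo -> (y - c)^-1 @[y --> F] --> 0.
Proof.
move=> Foo; apply/cvgr0Pnorm_lt => e e0; near=> y.
rewrite normfV invf_plt// ?posrE; first last.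
  by rewrite normr_gt0 subr_eq0; near: y; exact: near_neq.
rewrite (@lt_le_trans _ _ (`|y| - `|c|)) ?lerB_dist// ltrBrDr.
by near: y; move/cvgryPgt : Foo; apply.
Unshelve. all: by end_near. Qed.

(** The hypothesis on F covers both ends of the line. *)
Lemma cvg_ln_sqr_ratio (R : realType) (F : set_system R) (FF : Filter F)
    (m r x : R) :
  0 < r -> `|y| @[y --> F] --> +oo ->
  ln ((y + m) ^+ 2 + r ^+ 2) - ln ((y - x) ^+ 2) @[y --> F] --> 0.
Proof.
move=> r0 Foo.
have p0 := cvgr_inv_subr FF x Foo.
(* In terms of p = 1 / (y - x), which tends to 0, the ratio is a polynomial. *)
suff : ln ((1 + (x + m) * (y - x)^-1) ^+ 2 + (r * (y - x)^-1) ^+ 2)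
    @[y --> F] --> 0.
  apply: cvg_trans; apply: near_eq_cvg; near=> y.
  have yx : y - x != 0 by rewrite subr_eq0; near: y; exact: near_neq.
  rewrite -ln_div ?posrE ?sqr_addr_sqr_gt0// ?exprn_even_gt0//.
  by congr ln; field.
rewrite -[X in _ --> X](@ln1 R); apply: continuous_cvg.
  exact: continuous_ln.
have E : (1 + (x + m) * 0) ^+ 2 + (r * 0) ^+ 2 = 1 by ring.
rewrite -[X in _ --> X]E.
have c1 : 1 + (x + m) * (y - x)^-1 @[y --> F] --> 1 + (x + m) * 0.
  by apply: cvgD; [exact: cvg_cst|exact: cvgMl_tmp].
have c2 : r * (y - x)^-1 @[y --> F] --> r * 0 by exact: cvgMl_tmp.
by apply: cvgD; [exact: (cvgM c1 c1)|exact: (cvgM c2 c2)].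
Unshelve. all: by end_near. Qed.

Lemma cvgy_atan_div (R : realType) (m r : R) : 0 < r ->
  r^-1 * atan ((y + m) / r) @[y --> +oo] --> r^-1 * (pi / 2).
Proof.
move=> r0; apply: cvgMl_tmp.
have sy : (y + m) / r @[y --> +oo] --> +oo.
  by apply: gt0_cvgMly; [rewrite invr_gt0|exact: cvg_addrr].
exact: cvg_comp sy (@cvgy_atan R).
Qed.

Lemma cvgNy_atan_div (R : realType) (m r : R) : 0 < r ->
  r^-1 * atan ((y + m) / r) @[y --> -oo] --> - (r^-1 * (pi / 2)).
Proof.
move=> r0; apply/cvgNy_compNP.
have -> : (fun y => r^-1 * atan ((y + m) / r)) \o -%R =
    (fun y => - (r^-1 * atan ((y + - m) / r))).
  by apply/funext => y /=; rewrite -mulrN -atanN -mulNr opprB addrC.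
by apply: cvgN; exact: cvgy_atan_div.
Qed.

Lemma cvgy_normr (R : realType) : `|y| @[y --> +oo] --> (+oo : set_system R).
Proof.
apply/cvgryPgt => A; near=> y.
apply: (@lt_le_trans _ _ y); last exact: ler_norm.
by near: y; apply: nbhs_pinfty_gt; exact: num_real.
Unshelve. all: by end_near. Qed.

Lemma cvgNy_normr (R : realType) : `|y| @[y --> -oo] --> (+oo : set_system R).
Proof.
apply/cvgNy_compNP; apply: cvg_trans (@cvgy_normr R).
by apply: near_eq_cvg; near=> y; rewrite /= normrN.
Unshelve. all: by end_near. Qed.

(** * Hilbert transform of a dipole *)

Lemma integrable_setU (R : realType) (A B : set R) (f : R -> \bar R) :
  measurable A -> measurable B -> [disjoint A & B]%classic ->
  lebesgue_measure.-integrable A f -> lebesgue_measure.-integrable B f ->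
  lebesgue_measure.-integrable (A `|` B) f.
Proof.
move=> mA mB AB /integrableP[mfA fA] /integrableP[mfB fB].
have mf : measurable_fun (A `|` B) f by apply/measurable_funU.
apply/integrableP; split => //; rewrite ge0_integral_setU//.
  by apply: lte_add_pinfty.
exact: measurableT_comp.
Qed.

(** The part of [pv_primitive] that is smooth at x. *)
Definition pv_smooth (R : realType) (A B m r y : R) : R :=
  A * ln ((y + m) ^+ 2 + r ^+ 2) + B * (r^-1 * atan ((y + m) / r)).

(** For u = dipole a b m r, A = u(x) / 2 and B = r (H u)(x), a primitive of
    u(y) / (x - y), which in partial fractions is
      u(x) / (x - y) + (u(x) (y + m) + B) / ((y + m)^2 + r^2).
    Both logarithms carry the coefficient A = u(x) / 2, so
    they compensate at infinity, and A ln ((y - x)^2) takes the same value at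
    the points x - e and x + e. *)
Definition pv_primitive (R : realType) (A B m r x y : R) : R :=
  A * (ln ((y + m) ^+ 2 + r ^+ 2) - ln ((y - x) ^+ 2)) +
  B * (r^-1 * atan ((y + m) / r)).

Lemma is_derive_pv_primitive (R : realType) (a b m r x y : R) :
  0 < r -> y != x ->
  is_derive y (1 : R)
    (pv_primitive (dipole a b m r x / 2) (r * dipole (- b) a m r x) m r x)
    (dipole a b m r y / (x - y)).
Proof.
move=> r0 yx.
have yx0 : y - x != 0 by rewrite subr_eq0.
have xy0 : x - y != 0 by rewrite subr_eq0 eq_sym.
have N0 := sqr_addr_sqr_gt0 (y + m) r0.
have M0 := sqr_addr_sqr_gt0 (x + m) r0.
have dN := is_derive_ln_sqr N0.
have dD : is_derive y (1 : R) (fun y => ln ((y - x) ^+ 2)) (2 / (y - x)).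
  have D0 : 0 < (y + - x) ^+ 2 + 0 ^+ 2 by rewrite expr0n addr0 exprn_even_gt0.
  have -> : (fun y => ln ((y - x) ^+ 2)) =
      (fun y => ln ((y + - x) ^+ 2 + 0 ^+ 2)).
    by apply/funext => z; rewrite expr0n addr0.
  have -> : 2 / (y - x) = 2 * (y + - x) / ((y + - x) ^+ 2 + 0 ^+ 2).
    by rewrite expr0n addr0; field.
  exact: is_derive_ln_sqr.
have dA := is_derive_atan_div m y r0.
rewrite /pv_primitive; apply: is_derive_eq.
rewrite /dipole /GRing.scale/=; field.
by rewrite xy0 yx0 (gt_eqF N0) (gt_eqF M0).
Qed.

(** Expanding the numerator a (y + m) - b r around y = x isolates a multiple of
    x - y, which cancels the denominator; the rest is bounded since x - y stays
    away from 0. *)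
Lemma normr_dipole_div_le (R : realType) (a b m r x e y : R) :
  0 < r -> 0 < e -> e <= `|x - y| ->
  `|dipole a b m r y / (x - y)| <=
  (2 * `|a| + 2 * `|a * (x + m) - b * r| / e) * ((y + m) ^+ 2 + r ^+ 2)^-1.
Proof.
move=> r0 e0 exy.
have N0 := sqr_addr_sqr_gt0 (y + m) r0.
have xy0 : 0 < `|x - y| by rewrite (lt_le_trans e0).
have xyn0 : x - y != 0 by rewrite -normr_gt0.
have -> : dipole a b m r y / (x - y) =
    (2 * (a * (x + m) - b * r) / (x - y) - 2 * a) * ((y + m) ^+ 2 + r ^+ 2)^-1.
  by rewrite /dipole; field; rewrite xyn0 (gt_eqF N0).
rewrite normrM [X in _ * X]gtr0_norm ?invr_gt0// ler_pM2r ?invr_gt0//.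
rewrite addrC (le_trans (ler_normD _ _))// normrN normrM ger0_norm// lerD2l.
rewrite normrM normfV normrM ger0_norm// -!mulrA !ler_wpM2l//.
by rewrite ler_pV2 ?inE ?unitfE ?gt_eqF.
Qed.

Lemma dipole_continuous (R : realType) (a b m r y : R) : 0 < r ->
  {for y, continuous (dipole a b m r)}.
Proof.
move=> r0; have N0 := sqr_addr_sqr_gt0 (y + m) r0.
have dn : is_derive y (1 : R) (fun y => 2 * (a * (y + m) - b * r)) (2 * a).
  by apply: is_derive_eq; rewrite /GRing.scale/=; ring.
apply: continuousM; first exact: is_derive_continuous dn.
apply: continuousV; first by rewrite gt_eqF.
exact: is_derive_continuous (is_derive_sqr_addr m r y).
Qed.

(** The limits at both ends contribute pi times the answer, and the values at
    x - e and x + e the difference of the smooth part, as the singular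
    logarithms cancel. *)
Lemma pv_trunc_dipole (R : realType) (a b m r x e : R) : 0 < r -> 0 < e ->
  let S := pv_smooth (dipole a b m r x / 2) (r * dipole (- b) a m r x) m r in
  lebesgue_measure.-integrable [set y : R | e < `|x - y|]
     (EFin \o (fun y : R => dipole a b m r y / (x - y))) /\
  pv_trunc (dipole a b m r) x e =
    pi * dipole (- b) a m r x + (S (x - e) - S (x + e)).
Proof.
move=> r0 e0 S.
pose K := 2 * `|a| + 2 * `|a * (x + m) - b * r| / e.
pose f y := dipole a b m r y / (x - y).
pose g y := K * ((y + m) ^+ 2 + r ^+ 2)^-1.
pose F := pv_primitive (dipole a b m r x / 2) (r * dipole (- b) a m r x) m r x.
pose G y := K * (r^-1 * atan ((y + m) / r)).
have fg y : e <= `|x - y| -> `|f y| <= g y by exact: normr_dipole_div_le.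
have neq y : e <= `|x - y| -> x - y != 0.
  by move=> exy; rewrite -normr_gt0 (lt_le_trans e0).
have cf y : e <= `|x - y| -> {for y, continuous f}.
  move=> /neq xy; apply: continuousM; first exact: dipole_continuous.
  by apply: continuousV => //; apply: continuousB => //; exact: cst_continuous.
have cg y : {for y, continuous g}.
  apply: continuousM; first exact: cst_continuous.
  apply: continuousV; first by rewrite gt_eqF// sqr_addr_sqr_gt0.
  by apply: is_derive_continuous; exact: is_derive_sqr_addr.
have dF y : e <= `|x - y| -> is_derive y (1 : R) F (f y).
  by move=> /neq xy; apply: is_derive_pv_primitive => //; rewrite eq_sym -subr_eq0.
have dG y : is_derive y (1 : R) G (g y).
  by have dA := is_derive_atan_div m y r0; apply: is_deriveZ.
have FN : F y @[y --> -oo] --> - (dipole (- b) a m r x * (pi / 2)).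
  have -> : - (dipole (- b) a m r x * (pi / 2)) = (dipole a b m r x / 2) * 0 +
      (r * dipole (- b) a m r x) * - (r^-1 * (pi / 2)).
    by field; rewrite gt_eqF.
  apply: cvgD; apply: cvgMl_tmp; last exact: cvgNy_atan_div.
  exact: cvg_ln_sqr_ratio (@cvgNy_normr R).
have FP : F y @[y --> +oo] --> dipole (- b) a m r x * (pi / 2).
  have -> : dipole (- b) a m r x * (pi / 2) = (dipole a b m r x / 2) * 0 +
      (r * dipole (- b) a m r x) * (r^-1 * (pi / 2)).
    by field; rewrite gt_eqF.
  apply: cvgD; apply: cvgMl_tmp; last exact: cvgy_atan_div.
  exact: cvg_ln_sqr_ratio (@cvgy_normr R).
have GN : G y @[y --> -oo] --> K * - (r^-1 * (pi / 2)).
  by apply: cvgMl_tmp; exact: cvgNy_atan_div.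
have GP : G y @[y --> +oo] --> K * (r^-1 * (pi / 2)).
  by apply: cvgMl_tmp; exact: cvgy_atan_div.
have leN y : y <= x - e -> e <= `|x - y|.
  by move=> ?; rewrite (le_trans _ (ler_norm _))// lerBrDr addrC -lerBrDr.
have leP y : x + e <= y -> e <= `|x - y|.
  by move=> ?; rewrite distrC (le_trans _ (ler_norm _))// lerBrDr addrC.
have [iN RN] := @integrable_itvNyo_FTC R f F g G (x - e) _ _
  (fun y h => fg y (leN y h)) (fun y h => cf y (leN y h)) (fun y _ => cg y)
  (fun y h => dF y (leN y h)) (fun y _ => dG y) FN GN.
have [iP RP] := @integrable_itvoy_FTC R f F g G (x + e) _ _
  (fun y h => fg y (leP y h)) (fun y h => cf y (leP y h)) (fun y _ => cg y)
  (fun y h => dF y (leP y h)) (fun y _ => dG y) FP GP.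
have DE : [set y : R | e < `|x - y|] = `]-oo, x - e[ `|` `]x + e, +oo[.
  apply/seteqP; split => y /=; rewrite !in_itv/= andbT.
    by rewrite lter_normr => /orP[h|h]; [left|right]; lra.
  by move=> h; rewrite lter_normr; apply/orP; case: h => h; [left|right]; lra.
have disj : [disjoint `]-oo, x - e[ & `]x + e, +oo[]%classic.
  apply/disj_setPS => y /=; rewrite !in_itv/= andbT => -[h1 h2]; lra.
have iU : lebesgue_measure.-integrable
    (`]-oo, x - e[ `|` `]x + e, +oo[) (EFin \o f).
  exact: integrable_setU.
rewrite /pv_trunc DE; split => //.
rewrite Rintegral_setU// RN RP /F /S /pv_primitive /pv_smooth.
have -> : (x - e - x) ^+ 2 = e ^+ 2 by ring.
have -> : (x + e - x) ^+ 2 = e ^+ 2 by ring.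
field.
by rewrite gt_eqF.
Qed.

(** The residue a + i b becomes i (a + i b) = - b + i a, in accordance with the
    symbol - i sgn(k) on a function holomorphic in the lower half plane. *)
Lemma hilbert_dipole (R : realType) (a b m r x : R) : 0 < r ->
  hilbert_exists (dipole a b m r) x /\
  hilbert (dipole a b m r) x = dipole (- b) a m r x.
Proof.
move=> r0.
pose S := pv_smooth (dipole a b m r x / 2) (r * dipole (- b) a m r x) m r.
have cS : {for x, continuous S}.
  apply: continuousD; apply: continuousM; try exact: cst_continuous.
    exact: is_derive_continuous (is_derive_ln_sqr (sqr_addr_sqr_gt0 (x + m) r0)).
  exact: is_derive_continuous (is_derive_atan_div m x r0).
have lim_pv : pv_trunc (dipole a b m r) x e @[e --> 0^'+] -->
    pi * dipole (- b) a m r x.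
  suff : pi * dipole (- b) a m r x + (S (x - e) - S (x + e)) @[e --> 0^'+] -->
      pi * dipole (- b) a m r x.
    apply: cvg_trans; apply: near_eq_cvg; near=> e.
    by rewrite (pv_trunc_dipole _ _ _ _ _ _).2.
  rewrite -[X in _ --> X]addr0; apply: cvgD; first exact: cvg_cst.
  rewrite -[X in _ --> X](subrr (S x)); apply: cvg_at_right_filter.
  apply: cvgB; apply: continuous_cvg => //.
    rewrite -[X in _ --> X]subr0; apply: cvgB; [exact: cvg_cst|exact: cvg_id].
  rewrite -[X in _ --> X]addr0; apply: cvgD; [exact: cvg_cst|exact: cvg_id].
split.
  split; last by apply/cvg_ex; eexists; exact: lim_pv.
  by move=> e e0; have [] := pv_trunc_dipole a b m x r0 e0.
rewrite /hilbert (cvg_lim _ lim_pv)//.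
by rewrite mulrA mulVf ?mul1r// gt_eqF// pi_gt0.
Unshelve. all: by end_near. Qed.

(** * Norms of a dipole *)

Definition dipole_sqr_primitive (R : realType) (a b m r y : R) : R :=
  2 * (a ^+ 2 + b ^+ 2) * (r^-1 * atan ((y + m) / r)) +
  (2 * (b ^+ 2 - a ^+ 2) * (y + m) + 4 * (a * b * r)) *
    ((y + m) ^+ 2 + r ^+ 2)^-1.

Lemma is_derive_dipole_sqr_primitive (R : realType) (a b m r y : R) : 0 < r ->
  is_derive y (1 : R) (dipole_sqr_primitive a b m r) (dipole a b m r y ^+ 2).
Proof.
move=> r0; have N0 := sqr_addr_sqr_gt0 (y + m) r0.
have dA := is_derive_atan_div m y r0.
have dN : is_derive y (1 : R) (fun y => ((y + m) ^+ 2 + r ^+ 2)^-1)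
    (- ((y + m) ^+ 2 + r ^+ 2) ^- 2 *: (2 * (y + m))).
  by apply: (is_deriveV _ (is_derive_sqr_addr m r y)); rewrite gt_eqF.
rewrite /dipole_sqr_primitive; apply: is_derive_eq.
rewrite /dipole /GRing.scale/=; field.
by rewrite (gt_eqF N0).
Qed.

Lemma cvg_affine_div_sqr (R : realType) (F : set_system R) (FF : Filter F)
    (c d m r : R) : 0 < r -> `|y| @[y --> F] --> +oo ->
  (c * (y + m) + d) * ((y + m) ^+ 2 + r ^+ 2)^-1 @[y --> F] --> 0.
Proof.
move=> r0 Foo; have p0 := cvgr_inv_subr FF (- m) Foo.
(* In terms of p = 1 / (y + m), which tends to 0. *)
suff : (c * (y - - m)^-1 + d * ((y - - m)^-1 * (y - - m)^-1)) *
   (1 + (r * (y - - m)^-1) * (r * (y - - m)^-1))^-1 @[y --> F] --> 0.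
  apply: cvg_trans; apply: near_eq_cvg; near=> y.
  have ym : y != - m by near: y; exact: near_neq.
  have s0 : y + m != 0 by rewrite addr_eq0.
  by rewrite opprK; field; rewrite s0 gt_eqF ?sqr_addr_sqr_gt0.
have E : (c * 0 + d * (0 * 0)) * (1 + (r * 0) * (r * 0))^-1 = 0 by ring.
rewrite -[X in _ --> X]E.
have cp k : k * (y - - m)^-1 @[y --> F] --> k * 0 by exact: cvgMl_tmp.
apply: cvgM.
  by apply: cvgD; [exact: cp|apply: cvgMl_tmp; exact: cvgM].
apply: cvgV; first by rewrite !mulr0 addr0 oner_neq0.
by apply: cvgD; [exact: cvg_cst|apply: cvgM; exact: cp].
Unshelve. all: by end_near. Qed.

Lemma integral_dipole_sqr (R : realType) (a b m r : R) : 0 < r ->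
  (\int[lebesgue_measure]_y (dipole a b m r y ^+ 2)%:E =
   (2 * pi * ((a ^+ 2 + b ^+ 2) / r))%:E)%E.
Proof.
move=> r0.
pose f y := dipole a b m r y ^+ 2.
have cf y : {for y, continuous f}.
  have c := @dipole_continuous R a b m r y r0; exact: continuousM.
have mf (D : set R) : measurable D -> measurable_fun D (EFin \o f).
  move=> mD; apply/measurable_EFinP/(measurable_funS measurableT) => //.
  by apply: continuous_measurable_fun => y; exact: cf.
pose F := dipole_sqr_primitive a b m r.
have dF y : is_derive y (1 : R) F (f y).
  exact: is_derive_dipole_sqr_primitive.
have f0 y : 0 <= f y by exact: sqr_ge0.
pose k := (a ^+ 2 + b ^+ 2) / r * pi.
have FN : F y @[y --> -oo] --> - k.
  have -> : - k = (2 * (a ^+ 2 + b ^+ 2)) * - (r^-1 * (pi / 2)) + 0.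
    by rewrite /k; field; rewrite gt_eqF.
  apply: cvgD; first by apply: cvgMl_tmp; exact: cvgNy_atan_div.
  exact: cvg_affine_div_sqr (@cvgNy_normr R).
have FP : F y @[y --> +oo] --> k.
  have -> : k = (2 * (a ^+ 2 + b ^+ 2)) * (r^-1 * (pi / 2)) + 0.
    by rewrite /k; field; rewrite gt_eqF.
  apply: cvgD; first by apply: cvgMl_tmp; exact: cvgy_atan_div.
  exact: cvg_affine_div_sqr (@cvgy_normr R).
have T : [set: R] = `]-oo, 0[ `|` `[0, +oo[.
  apply/seteqP; split => // y _ /=; rewrite !in_itv/= andbT; apply/orP.
  by case: ltP.
have disj : [disjoint `]-oo, 0 : R[ & `[0 : R, +oo[]%classic.
  apply/disj_setPS => y /=; rewrite !in_itv/= andbT => -[h1 h2]; lra.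
rewrite T ge0_integral_setU//; first last.
- by move=> y _; rewrite lee_fin sqr_ge0.
- by rewrite -T; exact: mf.
rewrite -integral_itv_obnd_cbnd; last exact: mf.
have EN := @ge0_integral_itvNyo_FTC R f F 0 _ (fun y _ => f0 y)
  (fun y _ => cf y) (fun y _ => dF y) FN.
have EP := @ge0_integral_itvoy_FTC R f F 0 _ (fun y _ => f0 y)
  (fun y _ => cf y) (fun y _ => dF y) FP.
rewrite EN EP -EFinD; congr EFin; rewrite /k; ring.
Qed.

Lemma Lnorm2_dipole (R : realType) (a b m r : R) : 0 < r ->
  Lnorm (@lebesgue_measure R) 2%:E (EFin \o dipole a b m r) =
  (Num.sqrt (2 * pi) * (Num.sqrt (a ^+ 2 + b ^+ 2) / Num.sqrt r))%:E.
Proof.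
move=> r0; rewrite unlock.
have dE y : (`|(EFin \o dipole a b m r) y| `^ 2 = (dipole a b m r y ^+ 2)%:E)%E.
  by rewrite /= powR_mulrn// real_normK ?num_real.
under eq_integral do rewrite dE.
have M0 : 0 <= a ^+ 2 + b ^+ 2 by rewrite addr_ge0 ?sqr_ge0.
have p0 : 0 <= 2 * pi :> R by rewrite mulr_ge0 ?pi_ge0.
rewrite integral_dipole_sqr// poweR_EFin powR12_sqrt; last first.
  by rewrite mulr_ge0// divr_ge0// ltW.
by rewrite sqrtrM// (sqrtrM _ M0) sqrtrV// ltW.
Qed.

(** An essential supremum below the maximum would make a ball around x0, where f
    exceeds it by continuity, a null set. *)
Lemma Linfty_continuous (R : realType) (f : R -> R) (x0 : R) :
  continuous f -> (forall x, `|f x| <= `|f x0|) ->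
  Lnorm (@lebesgue_measure R) +oo%E (EFin \o f) = `|f x0|%:E.
Proof.
move=> cf fmax; rewrite unlock.
have muT : (0 < @lebesgue_measure R [set: R])%E.
  apply: (@lt_le_trans _ _ (lebesgue_measure (ball (0:R) 1))).
    by rewrite lebesgue_measure_ball// lte_fin; lra.
  by apply: le_measure => //; rewrite inE; [exact: measurable_ball|].
rewrite ifT//; apply/eqP; rewrite eq_le; apply/andP; split.
  by apply/ess_supP; apply: nearW => x; rewrite /= lee_fin.
rewrite leNgt; apply/negP => h.
have := ess_sup_ge (@lebesgue_measure R) (abse \o (EFin \o f)).
set y := ess_sup _ _ in h * => -[N [mN N0 subN]].
have cnf : {for x0, continuous (Num.norm \o f)}.
  by apply: continuous_comp; [exact: cf|exact: norm_continuous].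
have : \forall x \near x0, (y < `|f x|%:E)%E.
  case: (y) h => [s|//|_]; last by near=> x; rewrite ltNyr.
  rewrite lte_fin => /(cvgr_gt _ cnf); apply: filterS => x.
  by rewrite lte_fin.
move=> /nbhs_ballP[e /= e0 be].
have : (lebesgue_measure (ball x0 e) <= lebesgue_measure N)%E.
  apply: le_measure; rewrite ?inE//; first exact: measurable_ball.
  by move=> z /be /= yz; apply: subN => /=; apply/negP; rewrite -ltNge.
by rewrite N0 lebesgue_measure_ball ?(ltW e0)// lee_fin pmulrn_lle0// leNgt e0.
Unshelve. all: by end_near. Qed.

(** With M^2 = a^2 + b^2, the quadratic form
    (M + |b|) (s^2 + r^2) - 2 (|a| s + |b| r) r in (s, r) has zero discriminant;
    multiplied by M + |b| it is the square of (M + |b|) s - |a| r. *)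
Lemma normr_dipole_le (R : realType) (a b m r y : R) : 0 < r ->
  `|dipole a b m r y| <= (Num.sqrt (a ^+ 2 + b ^+ 2) + `|b|) / r.
Proof.
move=> r0; have N0 := sqr_addr_sqr_gt0 (y + m) r0.
have M0 : 0 <= a ^+ 2 + b ^+ 2 by rewrite addr_ge0 ?sqr_ge0.
set M := Num.sqrt _; have M2 : M ^+ 2 = `|a| ^+ 2 + `|b| ^+ 2.
  by rewrite sqr_sqrtr// !real_normK ?num_real.
have Mge0 : 0 <= M := sqrtr_ge0 _.
rewrite /dipole normrM normfV [`|_ ^+ 2 + _|]gtr0_norm// ler_pdivrMr//.
rewrite mulrAC ler_pdivlMr// normrM ger0_norm//.
have le1 : `|a * (y + m) - b * r| <= `|a| * `|y + m| + `|b| * r.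
  by rewrite (le_trans (ler_normB _ _))// !normrM (gtr0_norm r0).
rewrite -(real_normK (num_real (y + m))).
move: le1 M2; move: (normr_ge0 (y + m)) (normr_ge0 a) (normr_ge0 b).
move: `|_ - _| `|a| `|b| `|y + m| => n al be s s0 a0 b0 le1 M2.
have [Mb|Mb] := eqVneq (M + be) 0.
  have [al0 be0] : al = 0 /\ be = 0 by split; nra.
  move: le1; rewrite al0 be0 !mul0r addr0 => n0.
  by rewrite -be0 Mb mul0r pmulr_lle0// pmulr_rle0.
have Mb0 : 0 < M + be by rewrite lt0r Mb addr_ge0.
suff : 0 <= (M + be) *
    ((M + be) * (s ^+ 2 + r ^+ 2) - 2 * (al * s + be * r) * r).
  rewrite pmulr_rge0// subr_ge0 => /(le_trans _); apply.
  by rewrite ler_pM2r// ler_pM2l.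
have -> : (M + be) *
    ((M + be) * (s ^+ 2 + r ^+ 2) - 2 * (al * s + be * r) * r) =
    ((M + be) * s - al * r) ^+ 2 +
    (M ^+ 2 - (al ^+ 2 + be ^+ 2)) * r ^+ 2 by ring.
by rewrite M2 subrr mul0r addr0 sqr_ge0.
Qed.

(** The bound is attained where the square in [normr_dipole_le] vanishes, on the
    side of - m where a (y + m) and - b r have the same sign. *)
Lemma normr_dipole_max (R : realType) (a b m r : R) : 0 < r ->
  exists y, `|dipole a b m r y| = (Num.sqrt (a ^+ 2 + b ^+ 2) + `|b|) / r.
Proof.
move=> r0.
wlog b0 : a b / 0 <= b => [H|].
  have [/H//|/ltW b0] := leP 0 b.
  have [|y] := H (- a) (- b); first by rewrite oppr_ge0.
  rewrite !sqrrN normrN => <-; exists y.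
  by rewrite -normrN; congr `|_|; rewrite /dipole; ring.
have M0 : 0 <= a ^+ 2 + b ^+ 2 by rewrite addr_ge0 ?sqr_ge0.
rewrite (ger0_norm b0); set M := Num.sqrt _.
have M2 : M ^+ 2 = a ^+ 2 + b ^+ 2 by rewrite sqr_sqrtr.
have Mge0 : 0 <= M := sqrtr_ge0 _.
have [M_eq0|Mneq0] := eqVneq M 0.
  have [-> ->] : a = 0 /\ b = 0 by split; nra.
  by exists 0; rewrite M_eq0 /dipole !mul0r subrr mulr0 !mul0r normr0 addr0 mul0r.
have Mgt0 : 0 < M by rewrite lt0r Mneq0.
have Mb : 0 < M + b by rewrite ltr_wpDr.
exists (- (a * r / (M + b)) - m); rewrite /dipole subrK.
have -> : a * - (a * r / (M + b)) - b * r = - (r * M).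
  have -> : a * - (a * r / (M + b)) - b * r =
      - (r * (a ^+ 2 + b ^+ 2 + b * M) / (M + b)).
    by field; rewrite gt_eqF.
  by rewrite -M2; field; rewrite gt_eqF.
have -> : (- (a * r / (M + b))) ^+ 2 + r ^+ 2 = 2 * r ^+ 2 * M / (M + b).
  have -> : (- (a * r / (M + b))) ^+ 2 + r ^+ 2 =
    r ^+ 2 * (M ^+ 2 + 2 * M * b + (a ^+ 2 + b ^+ 2)) / (M + b) ^+ 2.
    by field; rewrite gt_eqF.
  by rewrite -M2; field; rewrite gt_eqF.
have -> : 2 * - (r * M) / (2 * r ^+ 2 * M / (M + b)) = - ((M + b) / r).
  by field; rewrite (gt_eqF r0) (gt_eqF Mgt0) (gt_eqF Mb).
by rewrite normrN ger0_norm// divr_ge0// ltW.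
Qed.

Lemma Linfty_dipole (R : realType) (a b m r : R) : 0 < r ->
  Lnorm (@lebesgue_measure R) +oo%E (EFin \o dipole a b m r) =
  ((Num.sqrt (a ^+ 2 + b ^+ 2) + `|b|) / r)%:E.
Proof.
move=> r0; have [y0 max_y0] := normr_dipole_max a b m r0.
rewrite (@Linfty_continuous _ _ y0) ?max_y0// => y.
  exact: dipole_continuous.
by rewrite normr_dipole_le.
Qed.

(** * Evolution of a dipole *)

(** The real form of A_t = i A^2 - nu A for A = w / (x - i v), where
    w = a + i b, v = r + i m, w' = - nu w and v' = w. *)
Lemma is_derive_dipole_param (R : realType) (nu x t : R) (a b m r : R -> R) :
  is_derive t (1 : R) a (- (nu * a t)) -> is_derive t (1 : R) b (- (nu * b t)) ->
  is_derive t (1 : R) m (b t) -> is_derive t (1 : R) r (a t) -> 0 < r t ->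
  is_derive t (1 : R) (fun t => dipole (a t) (b t) (m t) (r t) x)
    (dipole (a t) (b t) (m t) (r t) x * dipole (- b t) (a t) (m t) (r t) x
     - nu * dipole (a t) (b t) (m t) (r t) x).
Proof.
move=> da db dm dr r0; have N0 := sqr_addr_sqr_gt0 (x + m t) r0.
have dN : is_derive t (1 : R) (fun t => (x + m t) ^+ 2 + r t ^+ 2)
    (2 * (x + m t) * b t + 2 * r t * a t).
  by apply: is_derive_eq; rewrite add0r /GRing.scale/=; ring.
have dV : is_derive t (1 : R) (fun t => ((x + m t) ^+ 2 + r t ^+ 2)^-1)
    (- ((x + m t) ^+ 2 + r t ^+ 2) ^- 2 *:
       (2 * (x + m t) * b t + 2 * r t * a t)).
  by apply: (is_deriveV _ dN); rewrite gt_eqF.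
rewrite /dipole; apply: is_derive_eq; rewrite add0r /GRing.scale/=; field.
by rewrite gt_eqF.
Qed.

(** * The pole solution as a moving dipole *)

Lemma add_conjc_div (R : realType) (w z : R[i]) :
  w / z + w^*%C / z^*%C =
  (2 * (complex.Re w * complex.Re z + complex.Im w * complex.Im z) /
     (complex.Re z ^+ 2 + complex.Im z ^+ 2))%:C.
Proof.
case: w z => a b [c d]; apply/eqP; rewrite eq_complex/=.
by apply/andP; split; apply/eqP; rewrite ?sqrrN; ring.
Qed.

Lemma Re_omega_m1 (R : realType) (nu : R) (w0 : R[i]) (t : R) :
  complex.Re (omega_m1 nu w0 t) = complex.Re w0 * expR (- (nu * t)).
Proof. by rewrite /omega_m1; case: w0 => a b /=; ring. Qed.

Lemma Im_omega_m1 (R : realType) (nu : R) (w0 : R[i]) (t : R) :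
  complex.Im (omega_m1 nu w0 t) = complex.Im w0 * expR (- (nu * t)).
Proof. by rewrite /omega_m1; case: w0 => a b /=; ring. Qed.

Lemma cmod_omega_m1 (R : realType) (nu : R) (w0 : R[i]) (t : R) :
  cmod (omega_m1 nu w0 t) = cmod w0 * expR (- (nu * t)).
Proof.
rewrite /cmod /omega_m1 ComplexField.Normc.normcM /=.
by rewrite expr0n addr0 sqrtr_sqr gtr0_norm// expR_gt0.
Qed.

Lemma cmodE (R : realType) (z : R[i]) :
  cmod z = Num.sqrt (complex.Re z ^+ 2 + complex.Im z ^+ 2).
Proof. by case: z. Qed.

Lemma v_cE (R : realType) (nu : R) (w0 v0 : R[i]) (t : R) :
  v_c nu w0 v0 t = w0 * (nu^-1 * (1 - expR (- (nu * t))))%:C + v0.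
Proof. by rewrite /v_c rmorphM fmorphV mulrA. Qed.

Lemma Re_v_c (R : realType) (nu : R) (w0 v0 : R[i]) (t : R) :
  complex.Re (v_c nu w0 v0 t) =
  complex.Re w0 / nu * (1 - expR (- (nu * t))) + complex.Re v0.
Proof. by rewrite v_cE; case: w0 => a b; case: v0 => c d /=; ring. Qed.

Lemma Im_v_c (R : realType) (nu : R) (w0 v0 : R[i]) (t : R) :
  complex.Im (v_c nu w0 v0 t) =
  complex.Im w0 / nu * (1 - expR (- (nu * t))) + complex.Im v0.
Proof. by rewrite v_cE; case: w0 => a b; case: v0 => c d /=; ring. Qed.

Lemma omegaE (R : realType) (nu : R) (w0 v0 : R[i]) (x t : R) :
  omega nu w0 v0 x t =
  (dipole (complex.Re (omega_m1 nu w0 t)) (complex.Im (omega_m1 nu w0 t))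
     (complex.Im (v_c nu w0 v0 t)) (complex.Re (v_c nu w0 v0 t)) x)%:C.
Proof.
rewrite /omega.
have -> : x%:C + 'i%C * (v_c nu w0 v0 t)^*%C =
    (x%:C - 'i%C * v_c nu w0 v0 t)^*%C.
  by case: (v_c nu w0 v0 t) => r m /=; congr Complex; ring.
rewrite add_conjc_div /dipole.
case: (omega_m1 nu w0 t) (v_c nu w0 v0 t) => a b [r m] /=.
by congr (_%:C); congr (_ / _); ring.
Qed.

Lemma omegaRE (R : realType) (nu : R) (w0 v0 : R[i]) :
  omegaR nu w0 v0 = fun x t =>
  dipole (complex.Re (omega_m1 nu w0 t)) (complex.Im (omega_m1 nu w0 t))
     (complex.Im (v_c nu w0 v0 t)) (complex.Re (v_c nu w0 v0 t)) x.
Proof. by apply/funext => x; apply/funext => t; rewrite /omegaR omegaE. Qed.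

Lemma omegaR_solution (R : realType) (nu : R) (w0 v0 : R[i]) (I : set R) :
  0 < nu ->
  (forall t, I t -> 0 < complex.Re (v_c nu w0 v0 t)) ->
  is_solution nu I (omegaR nu w0 v0).
Proof.
move=> nu0 I_gt0 t /I_gt0 r0 x; rewrite omegaRE.
have [Hex HE] := hilbert_dipole
  (complex.Re (omega_m1 nu w0 t)) (complex.Im (omega_m1 nu w0 t))
  (complex.Im (v_c nu w0 v0 t)) x r0.
split; first exact: Hex.
rewrite [hilbert _ _]HE.
have dw c : is_derive t (1 : R) (fun t => c * expR (- (nu * t)))
    (- (nu * (c * expR (- (nu * t))))).
  by apply: is_derive_eq; rewrite /GRing.scale/=; ring.
have dv c d : is_derive t (1 : R) (fun t => c / nu * (1 - expR (- (nu * t))) + d)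
    (c * expR (- (nu * t))).
  by apply: is_derive_eq; rewrite /GRing.scale/=; field; rewrite gt_eqF.
move: r0; rewrite Re_v_c => r0.
have dD := is_derive_dipole_param x (dw (complex.Re w0)) (dw (complex.Im w0))
  (dv (complex.Im w0) (complex.Im v0)) (dv (complex.Re w0) (complex.Re v0)) r0.
rewrite /= Re_omega_m1 Im_omega_m1 Im_v_c.
rewrite [X in is_derive _ _ X](_ : _ = (fun s => dipole
  (complex.Re w0 * expR (- (nu * s))) (complex.Im w0 * expR (- (nu * s)))
  (complex.Im w0 / nu * (1 - expR (- (nu * s))) + complex.Im v0)
  (complex.Re w0 / nu * (1 - expR (- (nu * s))) + complex.Re v0) x))//.
by apply/funext => s; rewrite Re_omega_m1 Im_omega_m1 Im_v_c Re_v_c.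
Qed.

Lemma norm_Linfty_omegaR (R : realType) (nu : R) (w0 v0 : R[i])
    (t : R) : 0 < complex.Re (v_c nu w0 v0 t) ->
  norm_Linfty (omegaR nu w0 v0) t =
  ((cmod (omega_m1 nu w0 t) + `|complex.Im (omega_m1 nu w0 t)|) /
     complex.Re (v_c nu w0 v0 t))%:E.
Proof. by move=> r0; rewrite /norm_Linfty omegaRE Linfty_dipole// cmodE. Qed.

Lemma norm_L2_omegaR (R : realType) (nu : R) (w0 v0 : R[i])
    (t : R) : 0 < complex.Re (v_c nu w0 v0 t) ->
  norm_L2 (omegaR nu w0 v0) t =
  (Num.sqrt (2 * pi) *
     (cmod (omega_m1 nu w0 t) / Num.sqrt (complex.Re (v_c nu w0 v0 t))))%:E.
Proof. by move=> r0; rewrite /norm_L2 omegaRE Lnorm2_dipole// cmodE. Qed.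

(** * Global existence and the critical case *)

Lemma expR_decay_bounds (R : realType) (nu t : R) : 0 < nu -> 0 <= t ->
  0 < expR (- (nu * t)) <= 1.
Proof.
move=> nu0 t0; rewrite expR_gt0/= -(expR0 R) ler_expR oppr_le0.
by rewrite mulr_ge0// ltW.
Qed.

(** nu Re v_c = (Re w0 + nu Re v0) (1 - E) + nu Re v0 E is a combination of two
    nonnegative quantities with weights 1 - E and E, and the second one is
    positive. *)
Lemma Re_v_c_gt0 (R : realType) (nu : R) (w0 v0 : R[i]) (t : R) :
  0 < nu -> 0 < complex.Re v0 -> - (nu * complex.Re v0) <= complex.Re w0 ->
  0 <= t -> 0 < complex.Re (v_c nu w0 v0 t).
Proof.
move=> nu0 p0 le_w0 t0; rewrite Re_v_c.
have /andP[E0 E1] := expR_decay_bounds nu0 t0.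
move: (expR _) E0 E1 => E E0 E1.
have -> : complex.Re w0 / nu * (1 - E) + complex.Re v0 =
   nu^-1 * ((complex.Re w0 + nu * complex.Re v0) * (1 - E)
            + nu * complex.Re v0 * E) by field; rewrite gt_eqF.
rewrite mulr_gt0 ?invr_gt0// ltr_wpDl//; last by rewrite !mulr_gt0.
by rewrite mulr_ge0 ?subr_ge0// addrC -lerBlDl sub0r.
Qed.

Lemma Re_v_c_critical (R : realType) (nu : R) (w0 v0 : R[i]) (t : R) :
  0 < nu -> complex.Re w0 = - (nu * complex.Re v0) ->
  complex.Re (v_c nu w0 v0 t) = complex.Re v0 * expR (- (nu * t)).
Proof. by move=> nu0 w0E; rewrite Re_v_c w0E; field; rewrite gt_eqF. Qed.

Lemma cmod_gt0 (R : realType) (z : R[i]) : complex.Re z != 0 -> 0 < cmod z.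
Proof.
move=> z0; rewrite cmodE sqrtr_gt0.
by rewrite ltr_wpDr ?sqr_ge0// exprn_even_gt0.
Qed.

(** The residue and Re v_c decay at the same rate. *)
Lemma norm_Linfty_critical (R : realType) (nu : R) (w0 v0 : R[i]) (t : R) :
  0 < nu -> 0 < complex.Re v0 -> complex.Re w0 = - (nu * complex.Re v0) ->
  norm_Linfty (omegaR nu w0 v0) t =
  ((cmod w0 + `|complex.Im w0|) / complex.Re v0)%:E.
Proof.
move=> nu0 p0 w0E; have E0 := expR_gt0 (- (nu * t)).
have vE := Re_v_c_critical t nu0 w0E.
rewrite norm_Linfty_omegaR vE ?mulr_gt0// cmod_omega_m1 Im_omega_m1.
rewrite normrM (gtr0_norm E0); congr EFin; field.
by rewrite !gt_eqF.
Qed.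

(** The residue decays like E and the square root of Re v_c like the square root
    of E, which leaves a factor expR (- (nu * t / 2)). *)
Lemma norm_L2_critical (R : realType) (nu : R) (w0 v0 : R[i]) (t : R) :
  0 < nu -> 0 < complex.Re v0 -> complex.Re w0 = - (nu * complex.Re v0) ->
  norm_L2 (omegaR nu w0 v0) t =
  (Num.sqrt (2 * pi) * (cmod w0 / Num.sqrt (complex.Re v0)) *
   expR (- (nu * t / 2)))%:E.
Proof.
move=> nu0 p0 w0E; have E0 := expR_gt0 (- (nu * t / 2)).
have vE := Re_v_c_critical t nu0 w0E.
have EE : expR (- (nu * t)) = expR (- (nu * t / 2)) ^+ 2.
  by rewrite expr2 -expRD; congr expR; field.
rewrite norm_L2_omegaR vE ?mulr_gt0 ?expR_gt0// cmod_omega_m1 EE.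
rewrite (sqrtrM _ (ltW p0)) sqrtr_sqr (gtr0_norm E0); congr EFin; field.
by rewrite (gt_eqF E0) gt_eqF// sqrtr_gt0.
Qed.

Lemma cvgy_norm_L2_critical (R : realType) (nu : R) (w0 v0 : R[i]) :
  0 < nu -> 0 < complex.Re v0 -> complex.Re w0 = - (nu * complex.Re v0) ->
  norm_L2 (omegaR nu w0 v0) t @[t --> +oo] --> 0%E /\
  exists2 C : R, 0 < C &
    (norm_L2 (omegaR nu w0 v0) t * (expR (nu * t / 2))%:E)%E @[t --> +oo]
      --> C%:E.
Proof.
move=> nu0 p0 w0E.
pose C := Num.sqrt (2 * pi) * (cmod w0 / Num.sqrt (complex.Re v0)).
have L2E t := norm_L2_critical t nu0 p0 w0E; split.
  under eq_fun do rewrite L2E.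
  apply: cvg_EFin; first exact: nearW.
  rewrite -[X in _ --> X](mulr0 C); apply: cvgMl_tmp.
  have s : nu / 2 * t @[t --> +oo] --> +oo.
    by apply: gt0_cvgMry; [rewrite divr_gt0|exact: cvg_id].
  rewrite (_ : (fun t => expR (- (nu * t / 2))) =
    (fun x => expR (- x)) \o (fun t => nu / 2 * t)); last first.
    by apply/funext => t /=; congr (expR (- _)); ring.
  exact: cvg_comp s (@cvgr_expR R).
exists C.
  apply: mulr_gt0; first by rewrite sqrtr_gt0 mulr_gt0 ?pi_gt0.
  apply: divr_gt0; last by rewrite sqrtr_gt0.
  by apply: cmod_gt0; rewrite w0E oppr_eq0 gt_eqF// mulr_gt0.
rewrite (_ : (fun _ => _) = cst C%:E); first exact: cvg_cst.
apply/funext => t; rewrite /= L2E -EFinM; congr EFin.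
by rewrite -[RHS]mulr1 -[LHS]mulrA -expRD addNr expR0.
Qed.

(** * Blow-up in finite time *)

(** The condition on Re w0 puts the argument of the logarithm in ]0, 1[, so that
    [t_c] is the time at which E reaches this value. *)
Lemma expR_t_c (R : realType) (nu : R) (w0 v0 : R[i]) :
  0 < nu -> 0 < complex.Re v0 -> complex.Re w0 < - (nu * complex.Re v0) ->
  expR (- (nu * t_c nu w0 v0)) = 1 + nu * complex.Re v0 / complex.Re w0 /\
  0 < 1 + nu * complex.Re v0 / complex.Re w0 < 1.
Proof.
move=> nu0 p0 lt_w0; have np0 : 0 < nu * complex.Re v0 by rewrite mulr_gt0.
have a0 : complex.Re w0 < 0 by rewrite (lt_trans lt_w0)// oppr_lt0.
have q1 : nu * complex.Re v0 / complex.Re w0 < 0 by rewrite nmulr_llt0 ?invr_lt0.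
have q0 : 0 < 1 + nu * complex.Re v0 / complex.Re w0.
  have -> : 1 + nu * complex.Re v0 / complex.Re w0 =
     (- complex.Re w0 - nu * complex.Re v0) / - complex.Re w0.
    by field; rewrite lt_eqF.
  by rewrite divr_gt0 ?oppr_gt0// subr_gt0 ltrNr.
split; last by rewrite q0/= gtrDl.
rewrite /t_c mulrN opprK mulrA divff ?gt_eqF// mul1r.
by rewrite lnK.
Qed.

Lemma Re_v_c_blowup (R : realType) (nu : R) (w0 v0 : R[i]) (t : R) :
  0 < nu -> 0 < complex.Re v0 -> complex.Re w0 < - (nu * complex.Re v0) ->
  complex.Re (v_c nu w0 v0 t) =
  - complex.Re w0 / nu *
    (expR (- (nu * t)) - expR (- (nu * t_c nu w0 v0))).
Proof.
move=> nu0 p0 lt_w0; have [-> _] := expR_t_c nu0 p0 lt_w0.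
have np0 : 0 < nu * complex.Re v0 by rewrite mulr_gt0.
have a0 : complex.Re w0 < 0 by rewrite (lt_trans lt_w0)// oppr_lt0.
by rewrite Re_v_c; field; rewrite (lt_eqF a0) (gt_eqF nu0).
Qed.

Lemma Re_v_c_gt0_blowup (R : realType) (nu : R) (w0 v0 : R[i]) (t : R) :
  0 < nu -> 0 < complex.Re v0 -> complex.Re w0 < - (nu * complex.Re v0) ->
  (0 < complex.Re (v_c nu w0 v0 t)) = (t < t_c nu w0 v0).
Proof.
move=> nu0 p0 lt_w0; rewrite Re_v_c_blowup//.
have np0 : 0 < nu * complex.Re v0 by rewrite mulr_gt0.
have a0 : complex.Re w0 < 0 by rewrite (lt_trans lt_w0)// oppr_lt0.
by rewrite pmulr_rgt0 ?divr_gt0 ?oppr_gt0// subr_gt0 ltr_expR ltrN2 ltr_pM2l.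
Qed.

Lemma v_c_t_c (R : realType) (nu : R) (w0 v0 : R[i]) :
  0 < nu -> 0 < complex.Re v0 -> complex.Re w0 < - (nu * complex.Re v0) ->
  v_c nu w0 v0 (t_c nu w0 v0) = Complex 0 (- x_c w0 v0).
Proof.
move=> nu0 p0 lt_w0.
have np0 : 0 < nu * complex.Re v0 by rewrite mulr_gt0.
have a0 : complex.Re w0 < 0 by rewrite (lt_trans lt_w0)// oppr_lt0.
apply/eqP; rewrite eq_complex /=; apply/andP; split; apply/eqP.
  by rewrite Re_v_c_blowup// subrr mulr0.
have [E _] := expR_t_c nu0 p0 lt_w0.
by rewrite Im_v_c E /x_c; field; rewrite (lt_eqF a0) (gt_eqF nu0).
Qed.

Lemma cvgey_div (R : realType) (F : set_system R) (FF : Filter F)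
    (n h : R -> R) (c : R) :
  0 < c -> (\forall t \near F, c <= n t) -> (\forall t \near F, 0 < h t) ->
  h t @[t --> F] --> 0 -> (n t / h t)%:E @[t --> F] --> +oo%E.
Proof.
move=> c0 cn h0 hF; apply/cvgeryP.
apply: (@ger_cvgy _ _ _ _ (fun t => c * (h t)^-1)).
  near=> t; rewrite ler_pM2r; first by near: t.
  by rewrite invr_gt0; near: t.
by apply: gt0_cvgMry => //; apply/cvgrVy.
Unshelve. all: by end_near. Qed.

Lemma cvg_Re_v_c (R : realType) (nu : R) (w0 v0 : R[i]) :
  0 < nu -> 0 < complex.Re v0 -> complex.Re w0 < - (nu * complex.Re v0) ->
  complex.Re (v_c nu w0 v0 t) @[t --> (t_c nu w0 v0)^'-] --> 0.
Proof.
move=> nu0 p0 lt_w0; rewrite (_ : (fun t => _) = (fun t =>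
    - complex.Re w0 / nu * (expR (- (nu * t)) - expR (- (nu * t_c nu w0 v0))))).
  set T := t_c _ _ _.
  have dE : is_derive T (1 : R) (fun t => expR (- (nu * t)))
      (- (nu * expR (- (nu * T)))).
    by apply: is_derive_eq; rewrite /GRing.scale/=; ring.
  have cE : expR (- (nu * t)) - expR (- (nu * T)) @[t --> T^'-] --> 0.
    rewrite -[X in _ --> X](subrr (expR (- (nu * T)))).
    apply: cvgB; last exact: cvg_cst.
    by apply: cvg_at_left_filter; exact: is_derive_continuous dE.
  by rewrite -[X in _ --> X](mulr0 (- complex.Re w0 / nu)); exact: cvgMl_tmp.
by apply/funext => t; rewrite Re_v_c_blowup.
Qed.

(** * Self-similar profile at the blow-up time *)

Lemma ler_cmodD (R : realType) (x y : R[i]) : cmod (x + y) <= cmod x + cmod y.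
Proof. exact: le_normcD. Qed.

Lemma cmodN (R : realType) (x : R[i]) : cmod (- x) = cmod x.
Proof. exact: normcN. Qed.

Lemma cmodM (R : realType) (x y : R[i]) : cmod (x * y) = cmod x * cmod y.
Proof. exact: ComplexField.Normc.normcM. Qed.

Lemma cmodV (R : realType) (x : R[i]) : cmod x^-1 = (cmod x)^-1.
Proof. exact: ComplexField.Normc.normcV. Qed.

Lemma cmod_conj (R : realType) (x : R[i]) : cmod x^*%C = cmod x.
Proof. by case: x => a b; rewrite /cmod /= sqrrN. Qed.

Lemma cmod_real (R : realType) (x : R) : cmod x%:C = `|x|.
Proof. by rewrite /cmod /= expr0n addr0 sqrtr_sqr. Qed.

Lemma normr_Im_le (R : realType) (z : R[i]) : `|complex.Im z| <= cmod z.
Proof. by rewrite cmodE -sqrtr_sqr ler_wsqrtr// lerDr sqr_ge0. Qed.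

Lemma conjc_div (R : realType) (w z : R[i]) : w^*%C / z^*%C = (w / z)^*%C.
Proof. by rewrite rmorphM fmorphV. Qed.

(** The profile is the dipole obtained by freezing the residue at [t_c] and
    moving the poles linearly: the factor i of the profile turns xi_+ and - xi_-
    into the residues, and tau (xi - xi_+) = dc, tau (xi - xi_-) = conj dc. *)
Lemma self_similar_profileE (R : realType) (nu : R) (w0 v0 : R[i]) (x t : R) :
  t < t_c nu w0 v0 ->
  let wc := omega_m1 nu w0 (t_c nu w0 v0) in
  let dc := (x - x_c w0 v0)%:C + 'i%C * wc * (t_c nu w0 v0 - t)%:C in
  self_similar_profile nu w0 v0 x t = wc / dc + (wc / dc)^*%C.
Proof.
move=> ttc wc dc; rewrite /self_similar_profile /xi_plus /xi_minus -/wc.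
set tau := t_c nu w0 v0 - t in dc *.
have tau0 : tau%:C != 0 :> R[i].
  by rewrite (inj_eq (@complexI R) _ 0) gt_eqF// subr_gt0.
have E1 : dc = tau%:C * (((x - x_c w0 v0) / tau)%:C - - ('i%C * wc)).
  by rewrite rmorphM fmorphV opprK /dc; field.
have E2 : dc^*%C = tau%:C * (((x - x_c w0 v0) / tau)%:C - 'i%C * wc^*%C).
  rewrite E1 rmorphM; congr (_ * _); first by rewrite /= oppr0.
  by case: (wc) => a b /=; congr Complex; ring.
rewrite -conjc_div E2 [in RHS]E1 !invfM.
set p := (_ - - _)^-1; set q := (_ - _)^-1.
have i2 : 'i%C * 'i%C = -1 :> R[i] by rewrite -expr2 sqr_i.
transitivity (- ('i%C * 'i%C) * (wc * p / tau%:C + wc^*%C * q / tau%:C)).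
  by ring.
by rewrite i2; ring.
Qed.

(** Equivalent to 1 - y <= expR (- y). *)
Lemma expR_remainder_le (R : realType) (y : R) :
  expR y - 1 - y <= y * (expR y - 1).
Proof.
have := expR_ge1Dx (- y); rewrite expRN.
have E0 := expR_gt0 y.
rewrite -(ler_pM2r E0) mulVf ?gt_eqF// => h.
by lra.
Qed.

(** With y = nu tau, E = expR y and rho = (E - 1 - y) / nu, the two fractions
    have denominators d = dc + i wc rho and dc, and their difference is
    wc (E - 1) / d - i wc^2 rho / (d dc).  The imaginary parts of d and dc give
    |d| >= |Re wc| (E - 1) / nu and |dc| >= |Re wc| tau, which match
    E - 1 in the first term, and rho <= tau (E - 1) in the second one. *)
Lemma pole_term_error (R : realType) (nu tau : R) (wc dc : R[i]) :
  0 < nu -> 0 < tau -> complex.Re wc != 0 ->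
  complex.Im dc = complex.Re wc * tau ->
  cmod (wc * (expR (nu * tau))%:C /
          (dc + 'i%C * wc * ((expR (nu * tau) - 1 - nu * tau) / nu)%:C) -
        wc / dc) <=
  nu * (cmod wc / `|complex.Re wc|) + nu * (cmod wc / `|complex.Re wc|) ^+ 2.
Proof.
move=> nu0 tau0 a0 Imdc.
have y0 : 0 < nu * tau by rewrite mulr_gt0.
have E1 : 0 < expR (nu * tau) - 1 by rewrite subr_gt0 expR_gt1.
have rem0 : 0 <= expR (nu * tau) - 1 - nu * tau.
  by have := expR_ge1Dx (nu * tau); lra.
have rem1 := expR_remainder_le (nu * tau).
move: (expR _) E1 rem0 rem1 => E E1 rem0 rem1.
set rho := (E - 1 - nu * tau) / nu.
set d := dc + _.
have na0 : 0 < `|complex.Re wc| by rewrite normr_gt0.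
have Imd : complex.Im d = complex.Re wc * ((E - 1) / nu).
  have -> : (E - 1) / nu = tau + rho by rewrite /rho; field; rewrite gt_eqF.
  rewrite mulrDr -Imdc /d.
  by case: (dc) (wc) => dx dy [wx wy] /=; ring.
have dc_ge : `|complex.Re wc| * tau <= cmod dc.
  by rewrite (le_trans _ (normr_Im_le _))// Imdc normrM (gtr0_norm tau0).
have d_ge : `|complex.Re wc| * ((E - 1) / nu) <= cmod d.
  rewrite (le_trans _ (normr_Im_le _))// Imd normrM.
  by rewrite (gtr0_norm (divr_gt0 E1 nu0)).
have dc0 : 0 < cmod dc by rewrite (lt_le_trans _ dc_ge)// mulr_gt0.
have d0 : 0 < cmod d by rewrite (lt_le_trans _ d_ge)// mulr_gt0 ?divr_gt0.
have neq0 z : 0 < cmod z -> z != 0.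
  by apply: contraTneq => ->; rewrite (cmod_real 0) normr0 ltxx.
have -> : wc * E%:C / d - wc / dc =
    wc * (E - 1)%:C / d - wc * ('i%C * wc * rho%:C) / (d * dc).
  rewrite rmorphB /= [X in _ = _ - wc * X / _](_ : _ = d - dc); last first.
    by rewrite /d; ring.
  by field; rewrite !neq0.
rewrite (le_trans (ler_cmodD _ _))// cmodN !cmodM !cmodV !cmodM.
have -> : cmod 'i%C = 1 :> R by rewrite cmodE /= expr0n expr1n add0r sqrtr1.
rewrite mul1r !cmod_real (gtr0_norm E1) ger0_norm; last by rewrite divr_ge0// ltW.
have w_ge0 : 0 <= cmod wc by rewrite cmodE sqrtr_ge0.
move: (cmod wc) (cmod d) (cmod dc) w_ge0 d_ge dc_ge d0 dc0.
move=> W D Dc W0 dge dcge d0 dc0.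
move: `|_| na0 dge dcge => al al0 dge dcge.
apply: lerD.
  have -> : nu * (W / al) = W * (E - 1) / (al * ((E - 1) / nu)).
    by field; rewrite (gt_eqF nu0) (gt_eqF E1) gt_eqF.
  rewrite ler_wpM2l//; first by rewrite mulr_ge0// ltW.
  by rewrite lef_pV2// posrE mulr_gt0// divr_gt0.
have -> : nu * (W / al) ^+ 2 =
    W * (W * (tau * (E - 1))) / (al * ((E - 1) / nu) * (al * tau)).
  by field; rewrite (gt_eqF nu0) (gt_eqF E1) (gt_eqF tau0) gt_eqF.
apply: ler_pM.
- by rewrite !mulr_ge0// ?invr_ge0 ltW.
- by rewrite invr_ge0 mulr_ge0// ltW.
- rewrite !ler_wpM2l// /rho ler_pdivrMr//.
  by rewrite (le_trans rem1)// [leRHS]mulrC mulrA.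
- have P1 : 0 < al * ((E - 1) / nu) by rewrite mulr_gt0// divr_gt0.
  have P2 : 0 < al * tau by rewrite mulr_gt0.
  rewrite lef_pV2 ?posrE; [|exact: mulr_gt0|exact: mulr_gt0].
  by apply: ler_pM => //; exact: ltW.
Qed.

(** As v_c (t) = v_c (t_c) - wc (E - 1) / nu with E = expR (nu (t_c - t)), and
    i v_c (t_c) = x_c, the pole terms at time t are those of
    [pole_term_error]. *)
Lemma self_similar_error (R : realType) (nu : R) (w0 v0 : R[i]) (x t : R) :
  0 < nu -> 0 < complex.Re v0 -> complex.Re w0 < - (nu * complex.Re v0) ->
  t < t_c nu w0 v0 ->
  cmod (omega nu w0 v0 x t - self_similar_profile nu w0 v0 x t) <=
  2 * (nu * (cmod w0 / `|complex.Re w0|) +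
       nu * (cmod w0 / `|complex.Re w0|) ^+ 2).
Proof.
move=> nu0 p0 lt_w0 ttc.
have np0 : 0 < nu * complex.Re v0 by rewrite mulr_gt0.
have a0 : complex.Re w0 < 0 by rewrite (lt_trans lt_w0)// oppr_lt0.
rewrite self_similar_profileE//.
set wc := omega_m1 nu w0 _; set tau := t_c nu w0 v0 - t.
set dc := (x - x_c w0 v0)%:C + _.
have tau0 : 0 < tau by rewrite subr_gt0.
have E0 := expR_gt0 (- (nu * t_c nu w0 v0)).
have Rewc : complex.Re wc = complex.Re w0 * expR (- (nu * t_c nu w0 v0)).
  exact: Re_omega_m1.
have ratioE : cmod wc / `|complex.Re wc| = cmod w0 / `|complex.Re w0|.
  rewrite Rewc cmod_omega_m1 normrM (gtr0_norm E0); field.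
  by rewrite (gt_eqF E0) normr_eq0 lt_eqF.
have wE : omega_m1 nu w0 t = wc * (expR (nu * tau))%:C.
  rewrite /wc /omega_m1 -mulrA -rmorphM -expRD.
  by congr (_ * (expR _)%:C); rewrite /tau; ring.
have dE : x%:C - 'i%C * v_c nu w0 v0 t =
    dc + 'i%C * wc * ((expR (nu * tau) - 1 - nu * tau) / nu)%:C.
  have vE : v_c nu w0 v0 t = v_c nu w0 v0 (t_c nu w0 v0) -
      wc * ((expR (nu * tau) - 1) / nu)%:C.
    rewrite !v_cE /wc /omega_m1 -mulrA -rmorphM.
    have -> : expR (- (nu * t_c nu w0 v0)) * ((expR (nu * tau) - 1) / nu) =
       nu^-1 * (1 - expR (- (nu * t_c nu w0 v0))) -
       nu^-1 * (1 - expR (- (nu * t))).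
      have -> : expR (- (nu * t)) =
          expR (- (nu * t_c nu w0 v0)) * expR (nu * tau).
        by rewrite -expRD; congr expR; rewrite /tau; ring.
      by ring.
    by rewrite rmorphB; ring.
  rewrite vE v_c_t_c// /dc.
  have -> : Complex 0 (- x_c w0 v0) = - ('i%C * (x_c w0 v0)%:C) :> R[i].
    by rewrite /=; congr Complex; ring.
  have -> : (expR (nu * tau) - 1) / nu =
      tau + (expR (nu * tau) - 1 - nu * tau) / nu by field; rewrite gt_eqF.
  have DC (p q : R) : (p + q)%:C = p%:C + q%:C by rewrite rmorphD.
  have BC (p q : R) : (p - q)%:C = p%:C - q%:C by rewrite rmorphB.
  rewrite (DC tau) (BC x).
  have i2 : 'i%C * 'i%C = -1 :> R[i] by rewrite -expr2 sqr_i.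
  transitivity (x%:C + 'i%C * 'i%C * (x_c w0 v0)%:C + 'i%C * wc * (tau%:C +
    ((expR (nu * tau) - 1 - nu * tau) / nu)%:C)); first by ring.
  by rewrite i2; ring.
have omE : omega nu w0 v0 x t =
   omega_m1 nu w0 t / (x%:C - 'i%C * v_c nu w0 v0 t)
   + (omega_m1 nu w0 t / (x%:C - 'i%C * v_c nu w0 v0 t))^*%C.
  rewrite /omega -conjc_div; congr (_ + _ / _).
  by case: (v_c nu w0 v0 t) => r m /=; congr Complex; ring.
rewrite omE wE dE opprD addrACA -rmorphB.
rewrite (le_trans (ler_cmodD _ _))// cmod_conj -mulr2n mulr_natl ler_pMn2r//.
rewrite -ratioE; apply: pole_term_error => //.
- by rewrite Rewc mulf_eq0 (lt_eqF a0) (gt_eqF E0).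
- by rewrite /dc; case: (wc) => a b /=; ring.
Qed.

(** In both norms the residue stays above a positive constant while Re v_c tends
    to 0 from above. *)
Lemma cvgy_norms_blowup (R : realType) (nu : R) (w0 v0 : R[i]) :
  0 < nu -> 0 < complex.Re v0 -> complex.Re w0 < - (nu * complex.Re v0) ->
  norm_Linfty (omegaR nu w0 v0) t @[t --> (t_c nu w0 v0)^'-] --> +oo%E /\
  norm_L2 (omegaR nu w0 v0) t @[t --> (t_c nu w0 v0)^'-] --> +oo%E.
Proof.
move=> nu0 p0 lt_w0; set T := t_c nu w0 v0.
have np0 : 0 < nu * complex.Re v0 by rewrite mulr_gt0.
have a0 : complex.Re w0 < 0 by rewrite (lt_trans lt_w0)// oppr_lt0.
have w0_gt0 : 0 < cmod w0 by apply: cmod_gt0; rewrite lt_eqF.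
have v_gt0 : \forall t \near T^'-, 0 < complex.Re (v_c nu w0 v0 t).
  apply: filterS (nbhs_left_lt T) => t tT.
  by rewrite Re_v_c_gt0_blowup.
pose c := cmod w0 * expR (- (nu * T)).
have c0 : 0 < c by rewrite mulr_gt0 ?expR_gt0.
have w_ge : \forall t \near T^'-, c <= cmod (omega_m1 nu w0 t).
  apply: filterS (nbhs_left_lt T) => t tT.
  by rewrite cmod_omega_m1 ler_pM2l// ler_expR lerN2 ler_pM2l// ltW.
have cv := cvg_Re_v_c nu0 p0 lt_w0.
split.
  suff : ((cmod (omega_m1 nu w0 t) + `|complex.Im (omega_m1 nu w0 t)|) /
      complex.Re (v_c nu w0 v0 t))%:E @[t --> T^'-] --> +oo%E.
    apply: cvg_trans; apply: near_eq_cvg; apply: filterS v_gt0 => t vt.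
    by rewrite norm_Linfty_omegaR.
  apply: (cvgey_div _ c0) => //.
  by apply: filterS w_ge => t cw; rewrite ler_wpDr.
suff : (Num.sqrt (2 * pi) * cmod (omega_m1 nu w0 t) /
    Num.sqrt (complex.Re (v_c nu w0 v0 t)))%:E @[t --> T^'-] --> +oo%E.
  apply: cvg_trans; apply: near_eq_cvg; apply: filterS v_gt0 => t vt.
  by rewrite norm_L2_omegaR ?mulrA.
have s0 : 0 < Num.sqrt (2 * pi) :> R by rewrite sqrtr_gt0 mulr_gt0 ?pi_gt0.
apply: (cvgey_div _ (mulr_gt0 s0 c0)).
- by apply: filterS w_ge => t cw; rewrite ler_pM2l.
- by apply: filterS v_gt0 => t vt; rewrite sqrtr_gt0.
- rewrite -[X in _ --> X](@sqrtr0 R).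
  exact: cvg_comp cv (@sqrt_continuous R 0).
Qed.

Theorem mainTheorem6 (R : realType) (nu : R) (hnu : 0 < nu) :
  (forall (w0 v0 : R[i]) (hv0 : 0 < complex.Re v0),
    let w := omega_m1 nu w0 in
    let v := v_c nu w0 v0 in
    let u := omegaR nu w0 v0 in
    (* exact real-valued solution, and its norms, as long as Re v_c(t) > 0 *)
    [/\ forall t x : R, 0 <= t -> 0 < complex.Re (v t) -> complex.Im (omega nu w0 v0 x t) = 0,
        is_solution nu [set t : R | 0 <= t /\ 0 < complex.Re (v t)] u,
        forall t : R, 0 <= t -> 0 < complex.Re (v t) ->
          norm_Linfty u t = ((cmod (w t) + `|complex.Im (w t)|) / complex.Re (v t))%:E
      & forall t : R, 0 <= t -> 0 < complex.Re (v t) ->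
          norm_L2 u t
          = (Num.sqrt (2 * pi) * (cmod (w t) / Num.sqrt (complex.Re (v t))))%:E]
    /\
    (* (a) *)
    (- (nu * complex.Re v0) < complex.Re w0 ->
      (forall t : R, 0 < t -> 0 < complex.Re (v t)) /\
      is_solution nu [set t : R | 0 <= t] u)
    /\
    (* (b) *)
    (complex.Re w0 = - (nu * complex.Re v0) ->
      [/\ forall t : R, 0 <= t -> complex.Re (v t) = complex.Re v0 * expR (- (nu * t)),
          is_solution nu [set t : R | 0 <= t] u,
          forall t : R, 0 <= t -> norm_Linfty u t = norm_Linfty u 0,
          (0 < norm_Linfty u 0)%E
        & norm_L2 u t @[t --> +oo] --> 0%E /\
          exists2 C : R, 0 < C &
            (norm_L2 u t * (expR (nu * t / 2))%:E)%E @[t --> +oo] --> C%:E])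
    /\
    (* (c) *)
    (complex.Re w0 < - (nu * complex.Re v0) ->
      let tc := t_c nu w0 v0 in
      let xc := x_c w0 v0 in
      [/\ 0 < tc,
          forall t : R, 0 <= t -> (0 < complex.Re (v t) <-> t < tc),
          is_solution nu [set t : R | 0 <= t /\ t < tc] u,
          pole_up nu w0 v0 tc = xc%:C /\ pole_down nu w0 v0 tc = xc%:C
        & [/\ norm_Linfty u t @[t --> tc^'-] --> +oo%E,
              norm_L2 u t @[t --> tc^'-] --> +oo%E,
              exists C : R, \forall x \near xc & t \near tc^'-,
                cmod (omega nu w0 v0 x t - self_similar_profile nu w0 v0 x t)
                <= C
            & (nu%:E < norm_Linfty u 0)%E]]))
  /\
  (* in case (c), the initial L^2 norm can be arbitrarily small *)
  (forall eps delta : R, 0 < eps -> 0 < delta ->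
    exists w0 v0 : R[i],
      [/\ 0 < complex.Re v0,
          complex.Re w0 < - (nu * complex.Re v0),
          cmod v0 < delta
        & (norm_L2 (omegaR nu w0 v0) 0 < eps%:E)%E]).
Proof.
split=> [w0 v0 p0 w v u|e d e0 d0].
  split; last split; last split.
  - split.
    + by move=> t x _ _; rewrite omegaE.
    + by apply: omegaR_solution => // t [].
    + by move=> t _; exact: norm_Linfty_omegaR.
    + by move=> t _; exact: norm_L2_omegaR.
  - move=> lt_w0; split.
      by move=> t /ltW t0; apply: Re_v_c_gt0 => //; exact: ltW.
    apply: omegaR_solution => // t t0.
    by apply: Re_v_c_gt0 => //; exact: ltW.
  - move=> w0E; have L t := norm_Linfty_critical t hnu p0 w0E.
    split.
    + by move=> t _; exact: Re_v_c_critical.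
    + apply: omegaR_solution => // t t0.
      by apply: Re_v_c_gt0 => //; rewrite w0E.
    + by move=> t _; rewrite !L.
    + rewrite L lte_fin divr_gt0// ltr_wpDr// cmod_gt0//.
      by rewrite w0E oppr_eq0 gt_eqF// mulr_gt0.
    + exact: cvgy_norm_L2_critical.
  - move=> lt_w0 tc xc.
    have vtc := v_c_t_c hnu p0 lt_w0.
    have np0 : 0 < nu * complex.Re v0 by rewrite mulr_gt0.
    have a0 : complex.Re w0 < 0 by rewrite (lt_trans lt_w0)// oppr_lt0.
    split.
    + rewrite -(Re_v_c_gt0_blowup 0 hnu p0 lt_w0) Re_v_c.
      by rewrite mulr0 oppr0 expR0 subrr mulr0 add0r.
    + by move=> t _; rewrite /v Re_v_c_gt0_blowup.
    + apply: omegaR_solution => // t [_ ttc].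
      by rewrite Re_v_c_gt0_blowup.
    + rewrite /pole_up /pole_down vtc /xc; move: (x_c w0 v0) => c.
      by split; rewrite /=; congr Complex; ring.
    + have [Loo L2] := cvgy_norms_blowup hnu p0 lt_w0; split => //.
        exists (2 * (nu * (cmod w0 / `|complex.Re w0|) +
          nu * (cmod w0 / `|complex.Re w0|) ^+ 2)).
        exists ([set: R], [set t : R | t < tc]) => /=.
          by split; [exact: filterT|exact: nbhs_left_lt].
        by move=> [x t] [_ ttc]; exact: self_similar_error.
      have v0E : complex.Re (v_c nu w0 v0 0) = complex.Re v0.
        by rewrite Re_v_c mulr0 oppr0 expR0 subrr mulr0 add0r.
      rewrite norm_Linfty_omegaR v0E// lte_fin ltr_pdivlMr//.
      rewrite cmod_omega_m1 mulr0 oppr0 expR0 mulr1.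
      rewrite (@lt_le_trans _ _ `|complex.Re w0|)//.
        by rewrite ltr0_norm// ltrNr.
      by rewrite ler_wpDr// cmodE -sqrtr_sqr ler_wsqrtr// lerDl sqr_ge0.
(* For v0 = s > 0 and w0 = - 2 nu s the square norm is k times the square root
   of s. *)
pose k := Num.sqrt (2 * pi) * (2 * nu) : R.
have k0 : 0 < k.
  by rewrite mulr_gt0 ?mulr_gt0// sqrtr_gt0 mulr_gt0 ?pi_gt0.
pose s := Num.min (d / 2) ((e / (2 * k)) ^+ 2).
have s0 : 0 < s.
  by rewrite lt_min divr_gt0//= exprn_gt0// divr_gt0// mulr_gt0.
have ns0 : 0 < nu * s by rewrite mulr_gt0.
exists (- (2 * (nu * s)))%:C, s%:C; split => //.
- by rewrite /= ltrN2 mulr_natl mulr2n ltrDl.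
- rewrite cmod_real gtr0_norm// gt_min; apply/orP; left.
  by rewrite ltr_pdivrMr// mulr_natr mulr2n ltrDl.
have v0E : complex.Re (v_c nu (- (2 * (nu * s)))%:C s%:C 0) = s.
  by rewrite Re_v_c mulr0 oppr0 expR0 subrr mulr0 add0r.
rewrite norm_L2_omegaR v0E// cmod_omega_m1 mulr0 oppr0 expR0 mulr1.
rewrite cmod_real normrN gtr0_norm ?mulr_gt0// lte_fin.
have -> : Num.sqrt (2 * pi) * (2 * (nu * s) / Num.sqrt s) = k * Num.sqrt s.
  rewrite -[X in nu * X](sqr_sqrtr (ltW s0)) /k; field.
  by rewrite gt_eqF// sqrtr_gt0.
have : Num.sqrt s <= e / (2 * k).
  have ek : 0 < e / (2 * k) by rewrite divr_gt0// mulr_gt0.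
  rewrite -[leRHS](ger0_norm (ltW ek)) -sqrtr_sqr ler_wsqrtr//.
  by rewrite ge_min lexx orbT.
rewrite -(ler_pM2l k0) => /le_lt_trans; apply.
have -> : k * (e / (2 * k)) = e / 2 by field; rewrite gt_eqF.
by rewrite ltr_pdivrMr// mulr_natr mulr2n ltrDl.
Qed.
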